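(* Suppose $(n_k)_{k\ge1}$ is any sequence of positive integers increasing to infinity. Suppose that $X$ is some probability space, that $\tau$ is an ergodic measure-preserving transformation acting on $X$, and that $M_n$ is the usual ergodic averaging operator acting on $L^2(X)$ sending $f$ to $\frac1n\sum_{k=1}^n f(\tau^k x)$. Then $$\sum_{k=1}^\infty \left\|M_{n_{k+1}}-M_{n_k}\right\|_2=\infty,$$ where $\|\cdot\|_2$ denotes the operator norm on $L^2(X)$.
   Formalization: The probability space X is assumed nonatomic; without this the claim is false (on a one-point space, or N points permuted cyclically with n_k = kN, every difference M_{n_{k+1}} - M_{n_k} is 0). *)

(* Defs.v *)
From HB Require Import structures.
From mathcomp Require Import all_boot all_order all_algebra.
From mathcomp Require Import all_classical all_reals all_analysis.

Set Implicit Arguments.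
Unset Strict Implicit.
Unset Printing Implicit Defensive.

Import Order.TTheory GRing.Theory Num.Theory.
Import numFieldNormedType.Exports.

Local Open Scope classical_set_scope.
Local Open Scope ring_scope.

Section ergodic_theory.
Context {d : measure_display} {T : measurableType d} {R : realType}.
Variable P : probability T R.

Definition nonatomic : Prop :=
  forall A, measurable A -> (0 < P A)%E ->
    exists B, [/\ measurable B, B `<=` A & (0 < P B < P A)%E].

Definition measure_preserving (tau : T -> T) : Prop :=
  measurable_fun [set: T] tau /\
  forall A, measurable A -> P (tau @^-1` A) = P A.

Definition ergodic (tau : T -> T) : Prop :=
  forall A, measurable A -> tau @^-1` A = A -> P A = 0%E \/ P A = 1%E.

(* Operators on the real space L^2(P) are represented by maps on functions
   that respect a.e. equality and send [Lfun P 2%:E] to itself, so the supremum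
   over representatives of norm at most 1 is the norm of the induced operator
   on classes.  The value is an extended real; no boundedness is assumed. *)
Definition L2_opnorm (A : (T -> R) -> (T -> R)) : \bar R :=
  ereal_sup [set 'N[P]_2%:E[EFin \o A f]%E | f in
    [set f : T -> R | f \in Lfun P 2%:E /\ ('N[P]_2%:E[EFin \o f] <= 1)%E]].

End ergodic_theory.

Definition ergodic_average {T : Type} {R : realType} (tau : T -> T) (n : nat)
    (f : T -> R) : T -> R :=
  fun x => n%:R^-1 * \sum_(1 <= k < n.+1) f (iter k tau x).

(* Main.v *)
Require Import Defs.
From HB Require Import structures.
From mathcomp Require Import all_boot all_order all_algebra.
From mathcomp Require Import all_classical all_reals all_analysis.
From mathcomp Require Import measurable_realfun zify lra.

Set Implicit Arguments.
Unset Strict Implicit.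
Unset Printing Implicit Defensive.

Import Order.TTheory GRing.Theory Num.Theory.
Import numFieldNormedType.Exports.

Local Open Scope classical_set_scope.
Local Open Scope ring_scope.

(** Since the operator norm dominates what happens to a single function in the
    unit ball of L^2, a convergent series of norms would force the averages
    [M_(n k) f], for all [f] in that ball at once, to move little after some
    index [K].  This fails because ergodic averages converge without any
    uniform rate: there are sets [U] of probability about 1/2 that are so
    nearly invariant that the average of length [n K] of their indicator is
    still the indicator itself off a small set, whereas ergodicity forbids the
    later averages from staying close to it.

    Nearly invariant sets ([exists_almost_invariant]) come from hitting times.
    A nonatomic probability has a set [B] of tiny positive measure; by
    ergodicity almost every orbit meets [B], so the sets [hits_before B L] of
    points that meet [B] before time [L] grow from measure 0 to measure 1, in
    steps of at most [P B], and one of them has measure about 1/2.  The time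
    left until the next visit decreases by exactly one along the orbit, hence
    a point and its [k]-th image lie on different sides of [hits_before B L]
    only if a visit to [B] occurs within [k] steps of time 0 or of time [L].

    For [f] the indicator of such a [U], let [S] be the total variation of the
    sequence [M_(n k) f] from [K] on, a pointwise series whose integral is at
    most the tail of the series of operator norms, by the inequality between
    the L^1 and the L^2 norm.  The set [G] where the upper limit of
    [M_(n k) f] is at least 1/2 is exactly invariant, so it has probability 0
    or 1.  In the first case the averages start near 1 on [U] and get down to
    1/2, in the second they start near 0 off [U] and come close to 1/2; either
    way [S >= 1/4] on a set of probability at least 1/8
    ([total_variation_lower_bound]), so the tails of the series cannot tend
    to 0. *)

(** * Sets of small probability *)

Section probability_sets.
Context {d : measure_display} {T : measurableType d} {R : realType}.
Variable P : probability T R.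

Lemma le_prob (A B : set T) :
  measurable A -> measurable B -> A `<=` B -> (P A <= P B)%E.
Proof. by move=> mA mB AB; apply: le_measure => //; rewrite inE. Qed.

Lemma EFin_fine_prob (A : set T) : measurable A -> P A = (fine (P A))%:E.
Proof. by move=> mA; rewrite fineK// fin_num_measure. Qed.

(** A nonatomic measure splits any set of positive measure into two such
    parts, one of which has at most half of the mass; iterate. *)
Lemma exists_small_set (e : R) : nonatomic P -> 0 < e ->
  exists B, [/\ measurable B, (0 < P B)%E & (P B < e%:E)%E].
Proof.
move=> Pna e0.
have halve n : exists B, [/\ measurable B, (0 < P B)%E &
    (P B <= (2^-1 ^+ n)%:E)%E].
  elim: n => [|n [A [mA A0 An]]].
    by exists setT; rewrite probability_setT expr0.
  have [B [mB BA /andP[B0 BltA]]] := Pna A mA A0.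
  have mAB : measurable (A `\` B) by exact: measurableD.
  have : P A = (P (A `\` B) + P B)%E.
    by rewrite -{2}(setIidr BA) -measureDI.
  move: A0 An B0 BltA; rewrite (EFin_fine_prob mA) (EFin_fine_prob mB).
  rewrite (EFin_fine_prob mAB) -EFinD !lte_fin lee_fin.
  move=> A0 An B0 BltA [ABD].
  have [Ble|Bgt] := leP (fine (P B)) (2^-1 ^+ n.+1).
    by exists B; rewrite (EFin_fine_prob mB) lte_fin lee_fin.
  exists (A `\` B); rewrite (EFin_fine_prob mAB) lte_fin lee_fin; split => //.
    lra.
  by move: Bgt; rewrite exprS; lra.
have [n _ /(_ n (leqnn _)) nlt] := near_infty_natSinv_expn_lt (PosNum e0).
have [B [mB B0 Bn]] := halve n.
exists B; split => //; apply: (le_lt_trans Bn).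
by rewrite lte_fin exprVn -div1r.
Qed.

End probability_sets.

(** * Almost invariant sets of probability about one half *)

Section almost_invariant.
Context {d : measure_display} {T : measurableType d} {R : realType}.
Variables (P : probability T R) (tau : T -> T).
Hypothesis tauP : measure_preserving P tau.

Lemma measurable_iter k : measurable_fun [set: T] (iter k tau).
Proof.
elim: k => [|k IH]; first exact: measurable_id.
exact: (measurableT_comp tauP.1 IH).
Qed.

Lemma measurable_iter_preimage k (A : set T) :
  measurable A -> measurable (iter k tau @^-1` A).
Proof.
by move=> mA; have := measurable_iter k measurableT mA; rewrite setTI.
Qed.

Lemma prob_iter_preimage k (A : set T) :
  measurable A -> P (iter k tau @^-1` A) = P A.
Proof.
elim: k A => [//|k IH] A mA.
rewrite -(tauP.2 _ mA); apply: (IH (tau @^-1` A)).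
by have := tauP.1 measurableT _ mA; rewrite setTI.
Qed.

Definition hits_before (B : set T) (L : nat) : set T :=
  \bigcup_(k in `I_L) iter k tau @^-1` B.

Lemma measurable_hits_before B L : measurable B -> measurable (hits_before B L).
Proof.
by move=> mB; apply: bigcup_measurable => k _; exact: measurable_iter_preimage.
Qed.

Lemma hits_beforeS B L :
  hits_before B L.+1 = hits_before B L `|` iter L tau @^-1` B.
Proof.
apply/seteqP; split => x.
  move=> [k /= + Bk]; rewrite ltnS leq_eqVlt => /orP[/eqP <-|kL]; first by right.
  by left; exists k.
by move=> [[k /= kL Bk]|BL]; [exists k => //=; exact: ltnW|exists L => /=].
Qed.

Lemma prob_hits_beforeS B L : measurable B ->
  (P (hits_before B L.+1) <= P (hits_before B L) + P B)%E.
Proof.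
move=> mB; rewrite hits_beforeS -(prob_iter_preimage L mB).
apply: measureU2; first exact: measurable_hits_before.
exact: measurable_iter_preimage.
Qed.

(** Union bound: the set is covered by [L] preimages of [B]. *)
Lemma prob_hits_before_le B L : measurable B ->
  fine (P (hits_before B L)) <= L%:R * fine (P B).
Proof.
move=> mB; elim: L => [|L IH].
  by rewrite /hits_before II0 bigcup_set0 measure0 mul0r.
have := prob_hits_beforeS L mB.
rewrite (EFin_fine_prob P (measurable_hits_before L.+1 mB)).
rewrite (EFin_fine_prob P (measurable_hits_before L mB)) (EFin_fine_prob P mB).
by rewrite -EFinD lee_fin -natr1 mulrDl mul1r; lra.
Qed.

(** The set of points whose orbit visits [B] infinitely often is exactly
    invariant, unlike the set of points that visit it at least once.  Its
    measure is the limit of the measures of the sets of points that visit [B]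
    after time [m], each of which contains a preimage of [B]; so it is
    positive. *)
Lemma prob_recurrent B : ergodic P tau -> measurable B -> (0 < P B)%E ->
  P (lim_sup_set (fun k => iter k tau @^-1` B)) = 1%E.
Proof.
move=> erg mB B0; set F := fun k => _.
have mF k : measurable (F k) by exact: measurable_iter_preimage.
have mD : measurable (lim_sup_set F).
  by apply: bigcapT_measurable => m; apply: bigcup_measurable => k _.
have [|D0|//] := erg _ mD.
  apply/seteqP; split => x Dx m _.
    have [k /= mk Bk] := Dx m I.
    exists k.+1; first exact: leqW.
    by rewrite /F/= -iterS iterSr.
  have [[//|k] /= mk Bk] := Dx m.+1 I.
  by exists k => //; rewrite /F/= -iterSr.
suff : (P B <= P (lim_sup_set F))%E by rewrite D0 leNgt B0.
have FD : P (\bigcup_(k in [set k | (n <= k)%N]) F k) @[n --> \oo] -->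
    P (lim_sup_set F).
  apply: lim_sup_set_cvg => //; rewrite (le_lt_trans _ (ltry 1))//.
  by apply: probability_le1; apply: bigcup_measurable => k _.
rewrite -(cvg_lim _ FD)//; apply: lime_ge; first by apply/cvg_ex; eexists; exact: FD.
apply: nearW => m; rewrite -(prob_iter_preimage m mB).
apply: le_prob => //; first exact: measurable_iter_preimage.
  by apply: bigcup_measurable => k _.
by move=> x Bx; exists m => /=.
Qed.

Lemma hits_before_cvg B : ergodic P tau -> measurable B -> (0 < P B)%E ->
  P (hits_before B L) @[L --> \oo] --> 1%E.
Proof.
move=> erg mB B0.
have mU : measurable (\bigcup_L hits_before B L).
  by apply: bigcupT_measurable => L; exact: measurable_hits_before.
have -> : 1%E = P (\bigcup_L hits_before B L).
  apply/eqP; rewrite eq_le probability_le1// andbT.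
  rewrite -(prob_recurrent erg mB B0); apply: le_prob => //.
    apply: bigcapT_measurable => m; apply: bigcup_measurable => k _.
    exact: measurable_iter_preimage.
  move=> x /(_ 0%N I)[k _ Bk]; exists k.+1 => //; exists k => //=.
apply: nondecreasing_cvg_mu => //.
  by move=> L; exact: measurable_hits_before.
move=> L M LM; apply/subsetPset => x [k /= kL Bk].
by exists k => //=; exact: leq_trans LM.
Qed.

(** Existence of nearly invariant sets: orbit segments of length [N] that
    start off the small set [V] do not cross the boundary of [U].  This is
    what defeats uniform rates of convergence. *)
Lemma exists_almost_invariant (N : nat) (e : R) :
  nonatomic P -> ergodic P tau -> 0 < e ->
  exists U V : set T, [/\ measurable U, measurable V,
    4^-1 <= fine (P U) <= 3 / 4, fine (P V) <= e &
    forall x, ~ V x -> forall k, (k <= N)%N -> U (iter k tau x) <-> U x].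
Proof.
move=> Pna erg e0.
pose r := Num.min (4^-1) (e / (2 * N%:R + 1)).
have N0 : 0 <= N%:R :> R by [].
have r0 : 0 < r by rewrite lt_min invr_gt0 divr_gt0//; lra.
have [B [mB B0 Br]] := exists_small_set Pna r0.
have mU L := measurable_hits_before L mB.
have pB0 : 0 < fine (P B) by move: B0; rewrite (EFin_fine_prob P mB) lte_fin.
have pBr : fine (P B) < r by move: Br; rewrite (EFin_fine_prob P mB) lte_fin.
(* [U] is [hits_before B L] for the first [L] at which the measure reaches
   1/2; it overshoots by at most the measure of [B]. *)
have exL : exists L, 2^-1 <= fine (P (hits_before B L)).
  have /fine_cvgP[_ /cvgrPdist_lt/(_ 2^-1)] := hits_before_cvg erg mB B0.
  rewrite invr_gt0 => /(_ ltac:(by []))[L _ /(_ L (leqnn L))] /=.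
  by move=> h; exists L; move: h; rewrite ltr_norml; lra.
have [[|L] hL minL] := ex_minnP exL.
  by move: hL; rewrite /hits_before II0 bigcup_set0 measure0 /=; lra.
have UL : fine (P (hits_before B L)) < 2^-1.
  by rewrite ltNge; apply/negP => /minL; rewrite ltnn.
exists (hits_before B L.+1).
(* The exceptional points are those that visit [B] before time [N], or between
   the times [L.+1] and [L.+1 + N]. *)
exists (hits_before B N `|` iter L.+1 tau @^-1` hits_before B N).
have mI := measurable_iter_preimage L.+1 (mU N).
split => //; first exact: measurableU.
- have := prob_hits_beforeS L mB.
  rewrite (EFin_fine_prob P (mU L)) (EFin_fine_prob P (mU L.+1)).
  rewrite (EFin_fine_prob P mB) -EFinD lee_fin => h.
  have : r <= 4^-1 by rewrite ge_min lexx.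
  lra.
- have : r * (2 * N%:R + 1) <= e by rewrite -ler_pdivlMr ?ge_min ?lexx ?orbT//; lra.
  have : (P (hits_before B N `|` iter L.+1 tau @^-1` hits_before B N) <=
      P (hits_before B N) + P (iter L.+1 tau @^-1` hits_before B N))%E.
    exact: measureU2.
  rewrite (EFin_fine_prob P (measurableU _ _ (mU N) mI)).
  rewrite (prob_iter_preimage L.+1 (mU N)) (EFin_fine_prob P (mU N)).
  rewrite -EFinD lee_fin.
  have := prob_hits_before_le N mB.
  have : N%:R * fine (P B) <= N%:R * r by rewrite ler_wpM2l// ltW.
  lra.
- move=> x Vx k kN; split.
    move=> [j /= jL]; rewrite -iterD => Bj.
    have [jkL|Ljk] := ltnP (j + k) L.+1; first by exists (j + k)%N.
    case: Vx; right; exists (j + k - L.+1)%N => /=; first lia.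
    by rewrite -iterS -iterD subnK.
  move=> [j /= jL Bj]; have [jk|kj] := ltnP j k.
    by case: Vx; left; exists j => //=; exact: leq_trans kN.
  exists (j - k)%N => /=; first lia.
  by rewrite -iterD subnK.
Qed.

End almost_invariant.
(** * Invariance of level sets of upper limits *)

Section limsup_levels.
Context {R : realType}.

(** The condition says that the upper limit of [a] is at least [c]; the slack
    [m.+1%:R^-1] is what absorbs a perturbation of [a] that tends to 0. *)
Lemma limsup_ge_transfer (c : R) (a b : nat -> R) :
  a k - b k @[k --> \oo] --> 0 ->
  (forall m N, exists2 k, (N <= k)%N & c - m.+1%:R^-1 < a k) ->
  forall m N, exists2 k, (N <= k)%N & c - m.+1%:R^-1 < b k.
Proof.
move=> ab ha m N.
have e0 : 0 < m.+1%:R^-1 - m.+2%:R^-1 :> R.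
  by rewrite subr_gt0 ltf_pV2 ?posrE// ltr_nat.
have /cvgrPdist_lt/(_ _ e0)[K _ hK] := ab.
have [k Nk hk] := ha m.+1 (maxn N K).
exists k; first by rewrite (leq_trans _ Nk)// leq_maxl.
have := hK k (leq_trans (leq_maxr _ _) Nk).
rewrite /= sub0r normrN ltr_norml => /andP[_].
move: hk; move: (m.+1%:R^-1) (m.+2%:R^-1) => p q; lra.
Qed.

(** The level set is invariant on the nose, not only up to a null set, as the
    0-1 law for strictly invariant sets requires; a single threshold
    [c < u k x] would not be stable under a vanishing perturbation. *)
Lemma limsup_level_invariant {T : Type} (tau : T -> T) (c : R)
    (u : nat -> T -> R) :
  (forall x, u k (tau x) - u k x @[k --> \oo] --> 0) ->
  let G := \bigcap_m lim_sup_set (fun k => [set x | c - m.+1%:R^-1 < u k x]) in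
  tau @^-1` G = G.
Proof.
move=> hu G.
have GE x : G x <->
    forall m N, exists2 k, (N <= k)%N & c - m.+1%:R^-1 < u k x.
  split=> h; first by move=> m N; exact: (h m I N I).
  by move=> m _ N _; have [k] := h m N; exists k.
apply/seteqP; split => x /GE h; apply/GE.
  exact: (@limsup_ge_transfer c (u ^~ (tau x)) (u ^~ x) (hu x) h).
apply: (@limsup_ge_transfer c (u ^~ x) (u ^~ (tau x)) _ h).
rewrite -oppr0; under eq_fun do rewrite -opprB.
exact: cvgN (hu x).
Qed.

End limsup_levels.

(** * Ergodic averages along an orbit *)

Section ergodic_averages.
Context {T : Type} {R : realType} (tau : T -> T).

(** Telescoping: shifting the window by one exchanges its end points. *)
Lemma ergodic_average_shift (n : nat) (f : T -> R) x :
  ergodic_average tau n f (tau x) - ergodic_average tau n f x =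
  n%:R^-1 * (f (iter n.+1 tau x) - f (tau x)).
Proof.
rewrite /ergodic_average -mulrBr -sumrB; congr (_ * _).
have <- := @telescope_sumr _ 1 n.+1 (fun k => f (iter k tau x)) isT.
by apply: eq_bigr => k _; rewrite -iterSr.
Qed.

Lemma ergodic_average_shift_cvg (n : nat -> nat) (f : T -> R) x :
  n @ \oo --> \oo -> (forall y, `|f y| <= 1) ->
  ergodic_average tau (n k) f (tau x) - ergodic_average tau (n k) f x
    @[k --> \oo] --> 0.
Proof.
move=> n_infty f1; apply/cvgr0Pnorm_lt => e e0.
have e20 : 0 < e / 2 by rewrite divr_gt0.
have [N _ hN] := near_infty_natSinv_lt (PosNum e20).
have /cvgnyPge/(_ N.+1) := n_infty; apply: filterS => k Nk.
have nk0 : (0 < n k)%N := leq_ltn_trans (leq0n N) Nk.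
have := hN (n k).-1; rewrite /= -ltnS prednK// => /(_ Nk).
rewrite ergodic_average_shift normrM ger0_norm ?invr_ge0//.
set v := (n k)%:R^-1 => ve.
have v0 : 0 <= v by rewrite invr_ge0.
apply: (@le_lt_trans _ _ (v * 2)); last lra.
apply: ler_wpM2l => //; apply: (le_trans (ler_normB _ _)).
by rewrite -[2]/(1 + 1) lerD.
Qed.

Lemma ergodic_average_constant (n : nat) (f : T -> R) x : (0 < n)%N ->
  (forall k, (k <= n)%N -> f (iter k tau x) = f x) ->
  ergodic_average tau n f x = f x.
Proof.
move=> n0 fx; rewrite /ergodic_average.
rewrite (eq_big_nat _ _ (F2 := fun=> f x)); last first.
  by move=> k /andP[_ kn]; exact: fx.
by rewrite sumr_const_nat subSS subn0 -[f x *+ n]mulr_natl mulKf// pnatr_eq0 -lt0n.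
Qed.

End ergodic_averages.

(** * Lower bounds on the operator norm *)

Section L2_norms.
Context {d : measure_display} {T : measurableType d} {R : realType}.
Variable P : probability T R.

(** Hoelder's inequality against the constant 1, whose norm is 1 for a
    probability. *)
Lemma Lnorm1_le_Lnorm2 (f : T -> R) : measurable_fun [set: T] f ->
  (\int[P]_x `|f x|%:E <= 'N[P]_2%:E[EFin \o f])%E.
Proof.
move=> mf; have := @hoelder _ _ _ P f (cst 1) 2 2 mf (measurable_cst _).
rewrite Lnorm1 => /(_ ltac:(by []) ltac:(by []) ltac:(lra)).
have -> : (EFin \o cst 1%R : T -> \bar R) = cst 1%E by [].
rewrite Lnorm_cst1 (_ : _ [set: T] = 1%E); last exact: probability_setT.
rewrite poweR1r mule1.
by under eq_integral do rewrite /= mulr1.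
Qed.

Lemma indic_unit_ball (A : set T) : measurable A ->
  \1_A \in Lfun P 2%:E /\ ('N[P]_2%:E[EFin \o (\1_A : T -> R)] <= 1)%E.
Proof.
move=> mA.
have N1 : ('N[P]_2%:E[EFin \o (\1_A : T -> R)] <= 1)%E.
  rewrite unlock; under eq_integral => x _.
    rewrite (_ : (_ `^ _)%E = (\1_A x)%:E); last first.
      by rewrite /= indicE; case: (x \in A);
        rewrite /= ?normr1 ?normr0 ?powR1 ?powR0.
    over.
  have PA0 : 0 <= fine (P A) by rewrite fine_ge0.
  rewrite integral_indic// setIT [X in (X `^ _)%E](EFin_fine_prob P mA) poweR_EFin lee_fin.
  have := probability_le1 P mA; rewrite (EFin_fine_prob P mA) lee_fin => PA1.
  rewrite [leRHS](_ : 1 = 1 `^ 2^-1); last by rewrite powR1.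
  by apply: ge0_ler_powR; rewrite ?nnegrE ?invr_ge0.
split=> //; rewrite inE; apply/andP; split; rewrite inE/=.
  exact: measurable_indic.
by rewrite /finite_norm (le_lt_trans N1)// ltry.
Qed.

Lemma integral_norm_le_L2_opnorm (A : (T -> R) -> (T -> R)) (f : T -> R) :
  f \in Lfun P 2%:E -> ('N[P]_2%:E[EFin \o f] <= 1)%E ->
  measurable_fun [set: T] (A f) ->
  (\int[P]_x `|A f x|%:E <= L2_opnorm P A)%E.
Proof.
move=> f2 f1 mAf; apply: (le_trans (Lnorm1_le_Lnorm2 mAf)).
by apply: ereal_sup_ubound; exists f.
Qed.

(** The zero function is in the unit ball; the operator is arbitrary, so the
    bound comes from the sign of the norm of its image. *)
Lemma L2_opnorm_ge0 (A : (T -> R) -> (T -> R)) :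
  (0 <= L2_opnorm P A)%E.
Proof.
have [f2 f1] := indic_unit_ball (@measurable0 _ T).
apply: (le_trans (Lnorm_ge0 P 2%:E (EFin \o A \1_set0))).
by apply: ereal_sup_ubound; exists \1_set0.
Qed.

End L2_norms.
(** * A lower bound on the total variation of the averages *)

Section separation.
Context {d : measure_display} {T : measurableType d} {R : realType}.
Variables (P : probability T R) (tau : T -> T).
Hypotheses (tauP : measure_preserving P tau) (tau_erg : ergodic P tau).

Lemma measurable_ergodic_average n (f : T -> R) :
  measurable_fun [set: T] f -> measurable_fun [set: T] (ergodic_average tau n f).
Proof.
move=> mf; apply: measurable_funM => //; apply: measurable_sum => k.
exact: (measurableT_comp mf (measurable_iter tauP k)).
Qed.

(** By the 0-1 law [G] either fills [~` U] or misses [U], up to a null set. *)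
Lemma prob_invariant_splits (U G : set T) :
  measurable U -> measurable G -> tau @^-1` G = G ->
  4^-1 <= fine (P U) <= 3 / 4 ->
  4^-1 <= fine (P (~` U `&` G)) \/ 4^-1 <= fine (P (U `\` G)).
Proof.
move=> mU mG invG /andP[U1 U2].
have mCU : measurable (~` U) by exact: measurableC.
have mI : measurable (~` U `&` G) by exact: measurableI.
have mD : measurable (U `\` G) by exact: measurableD.
have [G0|G1] := tau_erg mG invG.
  right; suff : (P U <= P (U `\` G) + P G)%E.
    by rewrite G0 adde0 (EFin_fine_prob P mU) (EFin_fine_prob P mD) lee_fin; lra.
  apply: (le_trans _ (measureU2 P mD mG)); apply: le_prob => //.
    exact: measurableU.
  by move=> x Ux; have [Gx|nGx] := pselect (G x); [right|left].
left; suff : (P (~` U) <= P (~` U `&` G) + P (~` G))%E.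
  rewrite !probability_setC// G1 subee// adde0.
  by rewrite (EFin_fine_prob P mU) (EFin_fine_prob P mI) -EFinB lee_fin; lra.
have mCG : measurable (~` G) by exact: measurableC.
apply: (le_trans _ (measureU2 P mI mCG)); apply: le_prob => //.
  exact: measurableU.
by move=> x Ux; have [Gx|nGx] := pselect (G x); [left|right].
Qed.

(** The key estimate: whatever the starting index, some [f] in the unit ball
    has averages of total variation bounded below by an absolute constant.  As
    the lemma applies to every subsequence of times, it bounds all the tails
    of the series of operator norms. *)
Lemma total_variation_lower_bound (n : nat -> nat) :
  nonatomic P -> (forall k, (0 < n k)%N) -> n @ \oo --> \oo ->
  exists2 f : T -> R,
    [/\ measurable_fun [set: T] f, f \in Lfun P 2%:E &
        ('N[P]_2%:E[EFin \o f] <= 1)%E] &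
    (32^-1%:E <= \sum_(0 <= k <oo) \int[P]_x
      `|ergodic_average tau (n k.+1) f x - ergodic_average tau (n k) f x|%:E)%E.
Proof.
move=> Pna n_gt0 n_infty.
have e0 : 0 < 8^-1 :> R by rewrite invr_gt0.
have [U [V [mU mV PU PV UV]]] := exists_almost_invariant tauP (n 0%N) Pna tau_erg e0.
have [f2 f1] := indic_unit_ball P mU.
pose f : T -> R := \1_U.
have mf : measurable_fun [set: T] f by exact: measurable_indic.
exists f => //.
pose u k := ergodic_average tau (n k) f.
have mu k : measurable_fun [set: T] (u k) by exact: measurable_ergodic_average.
pose dif k x : \bar R := `|u k.+1 x - u k x|%:E.
have mdif k : measurable_fun [set: T] (dif k).
  apply/measurable_EFinP; apply: measurableT_comp => //.
  exact: measurable_funB.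
have dif0 k x : (0 <= dif k x)%E by rewrite lee_fin.
(* Pointwise total variation of the sequence of averages; it bounds the
   distance of any average from the first one. *)
pose S x : \bar R := (\sum_(0 <= k <oo) dif k x)%E.
have mS : measurable_fun [set: T] S by apply: ge0_emeasurable_sum.
have S0 x : (0 <= S x)%E by apply: nneseries_ge0.
have uS k x : (`|u k x - u 0%N x|%:E <= S x)%E.
  apply: (le_trans _ (nneseries_lim_ge k (fun i _ _ => dif0 i x))).
  rewrite sumEFin lee_fin -(telescope_sumr (u ^~ x))//.
  exact: ler_norm_sum.
rewrite -(@integral_nneseries _ _ _ P _ measurableT dif)//.
pose G := \bigcap_m lim_sup_set (fun k => [set x | 2^-1 - m.+1%:R^-1 < u k x]).
have mG : measurable G.
  apply: bigcapT_measurable => m; apply: bigcapT_measurable => N.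
  apply: bigcup_measurable => k _.
  have := mu k measurableT _ (measurable_itv `]2^-1 - m.+1%:R^-1, +oo[).
  rewrite setTI; congr measurable.
  by apply/seteqP; split => x /=; rewrite in_itv/= andbT.
have invG : tau @^-1` G = G.
  apply: limsup_level_invariant => x; apply: ergodic_average_shift_cvg => // y.
  by rewrite /f indicE; case: (y \in U); rewrite ?normr1 ?normr0.
have u0 x : ~ V x -> u 0%N x = f x.
  move=> Vx; apply: ergodic_average_constant => // k kn.
  rewrite /f !indicE; congr (_%:R); congr nat_of_bool.
  by apply/idP/idP => /set_mem/(UV x Vx k kn)/mem_set.
(* 1/32 is 1/4, the bound on [S], times 1/8 = 1/4 - 1/8, the measure of [W]
   without the exceptional set. *)
have bound W : measurable W -> 4^-1 <= fine (P W) ->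
    (forall x, W x -> ~ V x -> (4^-1%:E <= S x)%E) ->
    (32^-1%:E <= \int[P]_x S x)%E.
  move=> mW PW WS.
  have mWV : measurable (W `\` V) by exact: measurableD.
  have PWV : 8^-1 <= fine (P (W `\` V)).
    suff : (P W <= P (W `\` V) + P V)%E.
      rewrite (EFin_fine_prob P mW) (EFin_fine_prob P mWV) (EFin_fine_prob P mV).
      by rewrite -EFinD lee_fin; lra.
    apply: (le_trans _ (measureU2 P mWV mV)); apply: le_prob => //.
      exact: measurableU.
    by move=> x Wx; have [Vx|nVx] := pselect (V x); [right|left].
  apply: (@le_trans _ _ (\int[P]_(x in W `\` V) S x)%E); last first.
    by apply: ge0_subset_integral.
  apply: (@le_trans _ _ (\int[P]_(x in W `\` V) (cst (4^-1%:E) x))%E); last first.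
    apply: ge0_le_integral => //.
    - by move=> x _; rewrite /= lee_fin invr_ge0.
    - exact: measurable_funTS.
    - by move=> x [Wx Vx]; exact: WS.
  rewrite integral_cst// [X in (_ * X)%E](EFin_fine_prob P mWV) -EFinM lee_fin.
  lra.
have [PW|PW] := prob_invariant_splits mU mG invG PU.
  apply: (bound _ _ PW); first by apply: measurableI => //; exact: measurableC.
  (* [m = 3] gives an average above 1/2 - 1/4, while the first one is 0. *)
  move=> x [Ux Gx] Vx; have [k _ /= uk] := Gx 3%N I 0%N I.
  apply: (le_trans _ (uS k x)); rewrite lee_fin (u0 _ Vx) /f indicE memNset//=.
  by rewrite subr0; apply: (le_trans _ (ler_norm _)); lra.
apply: (bound _ _ PW); first exact: measurableD.
(* The first average is 1, and [S x < 1/4] would keep all the averages above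
   3/4, which puts [x] into [G]. *)
move=> x [Ux Gx] Vx; apply: contrapT => Sx; apply: Gx => m _ N _.
exists N => //=; rewrite ltNge; apply/negP => uN; apply: Sx.
apply: (le_trans _ (uS N x)); rewrite lee_fin (u0 _ Vx) /f indicE mem_set//=.
have m0 : 0 <= m.+1%:R^-1 :> R by [].
rewrite distrC; apply: (le_trans _ (ler_norm _)).
by move: uN m0; set q := m.+1%:R^-1; lra.
Qed.

End separation.

Theorem theorem2p13 (R : realType) (n : nat -> nat)
    (n_gt0 : forall k, (0 < n k)%N)
    (n_nondecreasing : forall i j, (i <= j)%N -> (n i <= n j)%N)
    (n_infty : n @ \oo --> \oo)
    (d : measure_display) (T : measurableType d) (P : probability T R)
    (P_nonatomic : nonatomic P)
    (tau : T -> T)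
    (tau_preserving : measure_preserving P tau)
    (tau_ergodic : ergodic P tau) :
  (\sum_(0 <= k <oo)
     L2_opnorm P (fun f => ergodic_average tau (n k.+1) f
                           - ergodic_average tau (n k) f)%R)%E = +oo%E.
Proof.
apply/eqP; rewrite eq_le leey/= leNgt; apply/negP => fin.
pose c k := L2_opnorm P (fun f => ergodic_average tau (n k.+1) f
                                  - ergodic_average tau (n k) f).
have c0 k : (0 <= c k)%E by exact: L2_opnorm_ge0.
have tail := nneseries_tail_cvg fin (fun k _ => c0 k).
have [K hK] : exists K, (\sum_(K <= k <oo) c k < 32^-1%:E)%E.
  have /fine_cvgP[[K1 _ h1] /cvgrPdist_lt/(_ 32^-1)] := tail.
  rewrite invr_gt0 => /(_ ltac:(by []))[K2 _ h2].
  exists (maxn K1 K2).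
  rewrite -[ltLHS]fineK; last by apply: h1; exact: leq_maxl.
  have := h2 (maxn K1 K2) (leq_maxr _ _).
  by rewrite /= sub0r normrN lte_fin => /(le_lt_trans (ler_norm _)).
have nK : (fun k => n (k + K)%N) @ \oo --> \oo.
  exact: cvg_comp (cvg_addnr K) n_infty.
have [f [mf f2 f1]] :=
  total_variation_lower_bound tau_preserving tau_ergodic P_nonatomic
    (fun k => n_gt0 (k + K)%N) nK.
rewrite leNgt => /negP; apply; apply: le_lt_trans hK.
rewrite -nneseries_addn//; apply: lee_nneseries => [k _ _|k _].
  by apply: integral_ge0 => x _; rewrite lee_fin.
apply: (@integral_norm_le_L2_opnorm _ _ _ P (fun g => ergodic_average tau (n (k + K).+1) g
  - ergodic_average tau (n (k + K)) g) f f2 f1).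
by apply: measurable_funB; exact: (measurable_ergodic_average tau_preserving).
Qed.
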